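(* Let $\mathbf{L}$ be a normal modal logic. Then its global consequence relation $\vdash_{\mathbf{L}}$ has an inconsistency lemma if and only if there exists $n\in\omega$ such that $\vdash_{\mathbf{L}}\boxplus^n v\to\Diamond_+^n\boxplus^{n+1}v$ (i.e., $\boxplus^n\alpha\to\Diamond_+^n\boxplus^{n+1}\alpha\in\mathbf{L}$ for all modal formulas $\alpha$).
   Context: $\omega=\{0,1,2,\dots\}$, $\mathbb{N}^+=\{1,2,\dots\}$; $v_1,v_2,\dots$ is a fixed sequence of distinct variables from the infinite set of variables, and $v=v_1$. A modal formula is a formula in the signature of classical propositional logic expanded by a unary connective $\Box$; $\Diamond\alpha$ abbreviates $\neg\Box\neg\alpha$. Put $\Box^0\alpha=\alpha$, $\Box^{n+1}\alpha=\Box\Box^n\alpha$, and similarly for $\Diamond^n$. For $n\in\omega$, $$\boxplus^n\varphi=\varphi\wedge\Box\varphi\wedge\dots\wedge\Box^n\varphi,\qquad \Diamond_+^n\varphi=\varphi\vee\Diamond\varphi\vee\dots\vee\Diamond^n\varphi.$$ A normal modal logic $\mathbf{L}$ is a set of modal formulas that contains all classical tautologies and $\Box(v_1\to v_2)\to(\Box v_1\to\Box v_2)$, and is closed under substitution, modus ponens and necessitation (from $\alpha$ infer $\Box\alpha$). Its global consequence relation $\vdash_{\mathbf{L}}$ is defined by: $\Gamma\vdash_{\mathbf{L}}\alpha$ iff $\alpha$ is derivable from $\Gamma\cup\mathbf{L}$ using the rules of modus ponens and necessitation. The theorems of $\vdash_{\mathbf{L}}$ are exactly the elements of $\mathbf{L}$.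 Inconsistency lemma. Let $\mathit{Fm}$ be the set of all modal formulas and $\mathit{Fm}(n)$ the set of those whose variables are among $v_1,\dots,v_n$. For $\Psi\subseteq\mathit{Fm}(n)$, $\Psi(\alpha_1,\dots,\alpha_n)$ is the result of substituting $\alpha_i$ for $v_i$ in all members of $\Psi$; $\Gamma\vdash\Pi$ means $\Gamma\vdash\alpha$ for all $\alpha\in\Pi$. A set $\Xi$ of formulas is inconsistent in $\vdash$ if $\Xi\vdash\alpha$ for all $\alpha\in\mathit{Fm}$. The system $\vdash$ has an inconsistency lemma if there are finite sets $\Psi_n\subseteq\mathit{Fm}(n)$ ($n\in\mathbb{N}^+$) such that for all $n\in\mathbb{N}^+$ and all $\Gamma\cup\{\alpha_1,\dots,\alpha_n\}\subseteq\mathit{Fm}$: $\Gamma\cup\{\alpha_1,\dots,\alpha_n\}$ is inconsistent in $\vdash$ iff $\Gamma\vdash\Psi_n(\alpha_1,\dots,\alpha_n)$. *)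

(* Defs.v *)
From mathcomp Require Import all_boot.
From mathcomp Require Import classical_sets cardinality.
Set Implicit Arguments.
Unset Strict Implicit.
Unset Printing Implicit Defensive.
Local Open Scope classical_set_scope.

Inductive form (V : Type) : Type :=
| Var of V
| Top
| Bot
| Neg of form V
| And of form V & form V
| Or of form V & form V
| Imp of form V & form V
| Box of form V.

Arguments Top {V}.
Arguments Bot {V}.

Section Formulas.
Variable V : Type.
Implicit Types (phi psi : form V).

Definition Dia phi := Neg (Box (Neg phi)).

Fixpoint boxplus (n : nat) phi : form V :=
  if n is m.+1 then And (boxplus m phi) (iter n (@Box V) phi) else phi.

Fixpoint diaplus (n : nat) phi : form V :=
  if n is m.+1 then Or (diaplus m phi) (iter n Dia phi) else phi.

Fixpoint subst (s : V -> form V) phi : form V :=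
  match phi with
  | Var x => s x
  | Top => Top
  | Bot => Bot
  | Neg a => Neg (subst s a)
  | And a b => And (subst s a) (subst s b)
  | Or a b => Or (subst s a) (subst s b)
  | Imp a b => Imp (subst s a) (subst s b)
  | Box a => Box (subst s a)
  end.

Fixpoint vars phi : set V :=
  match phi with
  | Var x => [set x]
  | Top | Bot => set0
  | Neg a | Box a => vars a
  | And a b | Or a b | Imp a b => vars a `|` vars b
  end.

(* Boolean evaluation in which boxed formulas behave as additional atoms,
   [b a] being the truth value of [Box a]. *)
Fixpoint beval (e : V -> bool) (b : form V -> bool) phi : bool :=
  match phi with
  | Var x => e x
  | Top => true
  | Bot => false
  | Neg a => ~~ beval e b a
  | And a1 a2 => beval e b a1 && beval e b a2
  | Or a1 a2 => beval e b a1 || beval e b a2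
  | Imp a1 a2 => beval e b a1 ==> beval e b a2
  | Box a => b a
  end.

(* For infinite V, the substitution instances of the box-free tautologies;
   a set closed under substitution contains all of them as soon as it contains
   the box-free ones. *)
Definition tautology : set (form V) := [set phi | forall e b, beval e b phi].

(* The fixed sequence of distinct variables is indexed from 0 here:
   [v 0] is v_1, [v 1] is v_2, and so on. *)
Record normal_modal_logic (v : nat -> V) (L : set (form V)) : Prop := {
  nml_taut : tautology `<=` L;
  nml_K : L (Imp (Box (Imp (Var (v 0)) (Var (v 1))))
                 (Imp (Box (Var (v 0))) (Box (Var (v 1)))));
  nml_subst : forall s phi, L phi -> L (subst s phi);
  nml_mp : forall phi psi, L phi -> L (Imp phi psi) -> L psi;
  nml_nec : forall phi, L phi -> L (Box phi)
}.

Inductive global_conseq (L Gamma : set (form V)) : form V -> Prop :=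
| gc_hyp phi : (Gamma `|` L) phi -> global_conseq L Gamma phi
| gc_mp phi psi : global_conseq L Gamma phi ->
    global_conseq L Gamma (Imp phi psi) -> global_conseq L Gamma psi
| gc_nec phi : global_conseq L Gamma phi -> global_conseq L Gamma (Box phi).

Definition Fm (v : nat -> V) (n : nat) : set (form V) :=
  [set phi | vars phi `<=` [set v i | i in [set i | (i < n)%N]]].

End Formulas.

Section InconsistencyLemma.
Variables (V : eqType) (v : nat -> V).

Definition assign n (alpha : 'I_n -> form V) (x : V) : form V :=
  if [pick i : 'I_n | v i == x] is Some i then alpha i else Var x.

Definition instance n (Psi : set (form V)) (alpha : 'I_n -> form V) :
  set (form V) := [set subst (assign alpha) psi | psi in Psi].

Definition inconsistent (conseq : set (form V) -> form V -> Prop)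
    (Xi : set (form V)) : Prop :=
  forall phi, conseq Xi phi.

Definition has_inconsistency_lemma
    (conseq : set (form V) -> form V -> Prop) : Prop :=
  exists Psi : nat -> set (form V), forall n, (0 < n)%N ->
    [/\ finite_set (Psi n), Psi n `<=` Fm v n &
        forall (Gamma : set (form V)) (alpha : 'I_n -> form V),
          inconsistent conseq (Gamma `|` range alpha) <->
          (forall phi, instance (Psi n) alpha phi -> conseq Gamma phi)].

End InconsistencyLemma.

(* Main.v *)
Require Import Defs.
From mathcomp Require Import all_boot.
From mathcomp Require Import classical_sets cardinality.

(** Write [Γ ⊢ φ] for the global consequence of [L], and call
    [⊞^n v → ◇_+^n ⊞^{n+1} v] the axiom of rank [n].

    Everything rests on the local deduction theorem for the global consequence
    ([local_deduction]): [Γ, α ⊢ φ] iff [Γ ⊢ ⊞^k α → φ] for some [k], where [k]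
    bounds the nesting of necessitations in the derivation.  In particular
    [Γ, α] is inconsistent iff [Γ ⊢ ¬⊞^k α] for some [k], and an inconsistency
    lemma amounts to a bound on [k] that is uniform in [Γ] and [α].

    From the axiom of rank [n] to such a bound: if [Γ ⊢ ¬⊞^{n+1} α] then
    necessitation refutes each [◇^i ⊞^{n+1} α], hence [◇_+^n ⊞^{n+1} α], and
    the axiom gives [Γ ⊢ ¬⊞^n α].  Since [⊞^n ⊞^j α] is [⊞^{n+j} α], the same
    step applied to [⊞^j α] takes [¬⊞^{n+j+1} α] to [¬⊞^{n+j} α], so every
    refutation descends to rank [n] ([refutation_descends]), and
    [¬⊞^n (v_1 ∧ ... ∧ v_m)] witnesses the inconsistency lemma.

    Conversely, let [Ψ] be the witness for one formula.  Taking [Γ = Ψ(v)] shows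
    that [Ψ(v), v] is inconsistent, so [Ψ(v) ⊢ ¬⊞^k v] for one fixed [k].  But
    [¬⊞^j v] is inconsistent with [v] for every [j], so [¬⊞^j v ⊢ Ψ(v)].  By cut
    [¬⊞^{k+1} v ⊢ ¬⊞^k v], and the deduction theorem followed by
    contraposition yields [⊞^k v → ◇_+^m ⊞^{k+1} v] for some [m].  Replacing [v]
    by [⊞^m v], and weakening [◇_+^m] to [◇_+^{k+m}], makes the ranks agree
    ([bounds_agree]). *)

Set Implicit Arguments.
Unset Strict Implicit.
Unset Printing Implicit Defensive.
Local Open Scope classical_set_scope.

(** * Theories closed under necessitation *)

(** The closure properties shared by all the sets [{φ | Γ ⊢ φ}]: closure under
    substitution is left out, since in general it is lost once there are
    hypotheses [Γ]. *)
Record theory (V : Type) (T : set (form V)) : Prop := {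
  th_taut : @tautology V `<=` T;
  th_K : forall a b, T (Imp (Box (Imp a b)) (Imp (Box a) (Box b)));
  th_mp : forall a b, T a -> T (Imp a b) -> T b;
  th_nec : forall a, T a -> T (Box a)
}.

(** Decides tautologies by splitting on the truth values of the schematic
    letters and of the boxed formulas, which [beval] treats as atoms. *)
Ltac prop_taut :=
  let e := fresh in let b := fresh in
  move=> e b /=;
  repeat match goal with
  | |- context [beval e b ?a] => case: (beval e b a)
  | |- context [b ?a] => case: (b a)
  end.

Section Theory.
Variables (V : Type) (T : set (form V)).
Hypothesis HT : theory T.
Implicit Types a b c d : form V.

Lemma th_taut1 a c : T a -> tautology (Imp a c) -> T c.
Proof. by move=> Ta /(th_taut HT); apply: th_mp. Qed.

Lemma th_taut2 a b c : T a -> T b -> tautology (Imp a (Imp b c)) -> T c.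
Proof. by move=> Ta Tb /(th_taut1 Ta); apply: th_mp. Qed.

Lemma th_imp_refl a : T (Imp a a).
Proof. by apply: th_taut => //; prop_taut. Qed.

Lemma th_imp_trans b a c : T (Imp a b) -> T (Imp b c) -> T (Imp a c).
Proof. by move=> ab bc; apply: (th_taut2 ab bc); prop_taut. Qed.

Lemma th_impK a b : T b -> T (Imp a b).
Proof. by move=> Tb; apply: (th_taut1 Tb); prop_taut. Qed.

Lemma th_andI c a b : T (Imp c a) -> T (Imp c b) -> T (Imp c (And a b)).
Proof. by move=> ca cb; apply: (th_taut2 ca cb); prop_taut. Qed.

Lemma th_andl a b : T (Imp (And a b) a).
Proof. by apply: th_taut => //; prop_taut. Qed.

Lemma th_andr a b : T (Imp (And a b) b).
Proof. by apply: th_taut => //; prop_taut. Qed.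

Lemma th_orE a b c : T (Imp a c) -> T (Imp b c) -> T (Imp (Or a b) c).
Proof. by move=> ac bc; apply: (th_taut2 ac bc); prop_taut. Qed.

Lemma th_orl a b : T (Imp a (Or a b)).
Proof. by apply: th_taut => //; prop_taut. Qed.

Lemma th_orr a b : T (Imp b (Or a b)).
Proof. by apply: th_taut => //; prop_taut. Qed.

Lemma th_contra a b : T (Imp a b) -> T (Imp (Neg b) (Neg a)).
Proof. by move=> ab; apply: (th_taut1 ab); prop_taut. Qed.

Lemma th_box_mono a b : T (Imp a b) -> T (Imp (Box a) (Box b)).
Proof. by move=> /(th_nec HT) /th_mp; apply => //; apply: th_K. Qed.

Lemma th_iter_box_mono n a b :
  T (Imp a b) -> T (Imp (iter n (@Box V) a) (iter n (@Box V) b)).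
Proof. by move=> ab; elim: n => //= n; apply: th_box_mono. Qed.

Lemma th_box_and a b : T (Imp (And (Box a) (Box b)) (Box (And a b))).
Proof.
have pair : T (Imp a (Imp b (And a b))) by apply: th_taut => //; prop_taut.
by apply: (th_taut2 (th_box_mono pair) (th_K HT b (And a b))); prop_taut.
Qed.

Lemma th_iter_box_and n a b :
  T (Imp (And (iter n (@Box V) a) (iter n (@Box V) b))
         (iter n (@Box V) (And a b))).
Proof.
elim: n => [|n IHn] /=; first exact: th_imp_refl.
exact: th_imp_trans (th_box_and _ _) (th_box_mono IHn).
Qed.

Lemma th_iter_nec n a : T a -> T (iter n (@Box V) a).
Proof. by move=> Ta; elim: n => //= n; apply: th_nec. Qed.

(** * Bounded boxes and diamonds *)

(** Up to provability [boxplus n a] is the infimum of the [□^i a], [i <= n];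
    the identities between iterated [⊞] are derived from this universal
    property. *)
Lemma boxplusE n i a : i <= n -> T (Imp (boxplus n a) (iter i (@Box V) a)).
Proof.
elim: n => [|n IHn] in i *; first by rewrite leqn0 => /eqP ->; apply: th_imp_refl.
rewrite leq_eqVlt => /predU1P[-> | lt_in]; first exact: th_andr.
exact: th_imp_trans (th_andl _ _) (IHn _ lt_in).
Qed.

Lemma boxplusI n c a :
  (forall i, i <= n -> T (Imp c (iter i (@Box V) a))) ->
  T (Imp c (boxplus n a)).
Proof.
elim: n => [|n IHn] ca; first exact: (ca 0).
apply: th_andI; last exact: (ca n.+1).
by apply: IHn => i le_in; apply/ca/leqW.
Qed.

Lemma boxplus_th n a : T a -> T (boxplus n a).
Proof.
move=> Ta; apply: (th_mp HT Ta); apply: boxplusI => i _.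
exact/th_impK/th_iter_nec.
Qed.

Lemma iter_box_boxplusI p n c a :
  (forall i, i <= n -> T (Imp c (iter (p + i) (@Box V) a))) ->
  T (Imp c (iter p (@Box V) (boxplus n a))).
Proof.
elim: n => [|n IHn] ca; first by move: (ca 0 isT); rewrite addn0.
apply: th_imp_trans (th_iter_box_and _ _ _); apply: th_andI.
  by apply: IHn => i le_in; apply/ca/leqW.
by have := ca n.+1 (leqnn _); rewrite iterD.
Qed.

Lemma boxplus_boxplusI n j a :
  T (Imp (boxplus (n + j) a) (boxplus n (boxplus j a))).
Proof.
apply: boxplusI => p le_pn; apply: iter_box_boxplusI => q le_qj.
exact/boxplusE/leq_add.
Qed.

Lemma boxplus_boxplusE n j a :
  T (Imp (boxplus n (boxplus j a)) (boxplus (n + j) a)).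
Proof.
apply: boxplusI => i le_i.
rewrite -(subnKC (geq_minl i n)) iterD.
apply: (th_imp_trans (boxplusE _ (geq_minr i n))).
apply/th_iter_box_mono/boxplusE.
by rewrite leq_subLR addn_minl leq_min leq_addr.
Qed.

Lemma boxplus_leq m n a : m <= n -> T (Imp (boxplus n a) (boxplus m a)).
Proof.
by move=> le_mn; apply: boxplusI => i le_im; apply/boxplusE/(leq_trans le_im).
Qed.

Lemma boxplusS_box k a : T (Imp (boxplus k.+1 a) (Box (boxplus k a))).
Proof. by apply: (@iter_box_boxplusI 1) => i le_ik; apply: boxplusE. Qed.

Lemma diaplusI n i a : i <= n -> T (Imp (iter i (@Dia V) a) (diaplus n a)).
Proof.
elim: n => [|n IHn] in i *; first by rewrite leqn0 => /eqP ->; apply: th_imp_refl.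
rewrite leq_eqVlt => /predU1P[-> | lt_in]; first exact: th_orr.
exact: th_imp_trans (IHn _ lt_in) (th_orl _ _).
Qed.

Lemma diaplusE n a c :
  (forall i, i <= n -> T (Imp (iter i (@Dia V) a) c)) ->
  T (Imp (diaplus n a) c).
Proof.
elim: n => [|n IHn] ac; first exact: (ac 0).
apply: th_orE; last exact: (ac n.+1).
by apply: IHn => i le_in; apply/ac/leqW.
Qed.

Lemma iter_dia_mono n a b :
  T (Imp a b) -> T (Imp (iter n (@Dia V) a) (iter n (@Dia V) b)).
Proof. by move=> ab; elim: n => //= n IHn; apply/th_contra/th_box_mono/th_contra. Qed.

Lemma diaplus_mono m n a b :
  m <= n -> T (Imp a b) -> T (Imp (diaplus m a) (diaplus n b)).
Proof.
move=> le_mn ab; apply: diaplusE => i le_im.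
exact: th_imp_trans (iter_dia_mono i ab) (diaplusI _ (leq_trans le_im le_mn)).
Qed.

(** De Morgan duality, in the form in which the deduction theorem produces it. *)
Lemma diaplus_of_boxplus_neg m b c :
  T (Imp (boxplus m (Neg b)) (Neg c)) -> T (Imp c (diaplus m b)).
Proof.
suff dual : T (Imp (Neg (diaplus m b)) (boxplus m (Neg b))).
  by move=> /(th_imp_trans dual) nn; apply: (th_taut1 nn); prop_taut.
apply: boxplusI => i /(diaplusI b) /th_contra /th_imp_trans; apply.
elim: i => [|i IHi] /=; first exact: th_imp_refl.
by apply: (th_taut1 (th_box_mono IHi)); prop_taut.
Qed.

Lemma diaplus_refuted n a : T (Imp a Bot) -> T (Imp (diaplus n a) Bot).
Proof.
move=> aF; apply: diaplusE => i _.
elim: i => //= i IHi; have nec : T (Box (Neg (iter i (@Dia V) a))).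
  by apply: th_nec => //; apply: (th_taut1 IHi); prop_taut.
by apply: (th_taut1 nec); prop_taut.
Qed.

(** The axiom of rank [n] at [⊞^j a] lowers the rank of a refutation from
    [n + j + 1] to [n + j]; iterating reaches [n]. *)
Lemma refutation_descends n :
  (forall a, T (Imp (boxplus n a) (diaplus n (boxplus n.+1 a)))) ->
  forall k a, T (Imp (boxplus k a) Bot) -> T (Imp (boxplus n a) Bot).
Proof.
move=> ax k a refk; have [le_kn | /ltnW le_nk] := leqP k n.
  exact: th_imp_trans (boxplus_leq _ le_kn) refk.
move: refk; rewrite -(subnKC le_nk).
elim: (k - n) => [|j IHj]; first by rewrite addn0.
rewrite addnS -addSn => refS; apply: IHj.
apply: (th_imp_trans (boxplus_boxplusI _ _ _)).
apply: (th_imp_trans (ax _)).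
exact/diaplus_refuted/(th_imp_trans (boxplus_boxplusE _ _ _)).
Qed.

(** At [⊞^m a] the hypothesis reads [⊞^{k+m} a → ◇_+^m ⊞^{k+m+1} a], and
    [◇_+^m] is below [◇_+^{k+m}]. *)
Lemma bounds_agree k m :
  (forall a, T (Imp (boxplus k a) (diaplus m (boxplus k.+1 a)))) ->
  forall a, T (Imp (boxplus (k + m) a)
                   (diaplus (k + m) (boxplus (k + m).+1 a))).
Proof.
move=> ax a; apply: (th_imp_trans (boxplus_boxplusI _ _ _)).
apply: (th_imp_trans (ax _)); apply: diaplus_mono; first exact: leq_addl.
by rewrite -addSn; apply: boxplus_boxplusE.
Qed.

(** * Finite conjunctions *)

Lemma bigandE (I : eqType) (r : seq I) (alpha : I -> form V) i :
  i \in r -> T (Imp (\big[@And V/Top]_(j <- r) alpha j) (alpha i)).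
Proof.
elim: r => //= j r IHr; rewrite big_cons inE => /predU1P[-> | /IHr].
  exact: th_andl.
exact/th_imp_trans/th_andr.
Qed.

Lemma bigand_th (I : Type) (r : seq I) (alpha : I -> form V) :
  (forall i, T (alpha i)) -> T (\big[@And V/Top]_(j <- r) alpha j).
Proof.
move=> Talpha; elim: r => [|i r IHr]; last rewrite big_cons.
  by rewrite big_nil; apply: th_taut => //; prop_taut.
by apply: (th_taut2 (Talpha i) IHr); prop_taut.
Qed.

End Theory.

(** * Substitution *)

Section Substitution.
Variable V : Type.
Implicit Types (a : form V) (s : V -> form V).

Lemma subst_boxplus s n a : subst s (boxplus n a) = boxplus n (subst s a).
Proof.
elim: n => //= n ->; congr (And _ (Box _)).
by elim: n => //= n ->.
Qed.

Lemma subst_diaplus s n a : subst s (diaplus n a) = diaplus n (subst s a).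
Proof.
elim: n => //= n ->; congr (Or _ (Dia _)).
by elim: n => //= n ->.
Qed.

Lemma subst_axiom s k m l a :
  subst s (Imp (boxplus k a) (diaplus m (boxplus l a)))
  = Imp (boxplus k (subst s a)) (diaplus m (boxplus l (subst s a))).
Proof. by rewrite -!subst_boxplus -subst_diaplus. Qed.

Lemma subst_bigand s (I : Type) (r : seq I) (alpha : I -> form V) :
  subst s (\big[@And V/Top]_(i <- r) alpha i)
  = \big[@And V/Top]_(i <- r) subst s (alpha i).
Proof. exact: (big_morph (subst s)). Qed.

Lemma vars_boxplus n a : vars (boxplus n a) `<=` vars a.
Proof.
elim: n => [|n IHn] //= x [/IHn //|].
by elim: n {IHn} => //= n.
Qed.

Lemma vars_bigand (I : Type) (r : seq I) (alpha : I -> form V) (X : set V) :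
  (forall i, vars (alpha i) `<=` X) ->
  vars (\big[@And V/Top]_(i <- r) alpha i) `<=` X.
Proof.
move=> sub; elim: r => [|i r IHr]; first by rewrite big_nil.
by rewrite big_cons /= subUset; split.
Qed.

Lemma subst_Var s a : (forall x, s x = Var x) -> subst s a = a.
Proof. by move=> sV; elim: a => //= [a ->|a -> b ->|a -> b ->|a -> b ->|a ->]. Qed.

End Substitution.

Lemma assignE (V : eqType) (v : nat -> V) (v_inj : injective v) n
    (alpha : 'I_n -> form V) (i : 'I_n) : assign v alpha (v i) = alpha i.
Proof.
rewrite /assign; case: pickP => [j /eqP /v_inj /val_inj -> //|/(_ i)].
by rewrite eqxx.
Qed.

(** * Global consequence *)

Section GlobalConsequence.
Variables (V : eqType) (v : nat -> V).
Hypothesis v_inj : injective v.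
Variable L : set (form V).
Hypothesis HL : normal_modal_logic v L.
Implicit Types (Gamma Delta : set (form V)) (a c phi : form V).

Lemma gc_theory Gamma : theory (global_conseq L Gamma).
Proof.
split=> [a Ta|a b|a b|a].
- by apply: gc_hyp; right; apply: nml_taut HL _ Ta.
- apply: gc_hyp; right.
  have := nml_subst HL (fun x => if x == v 0 then a else b) (nml_K HL).
  by rewrite /= eqxx (inj_eq v_inj).
- exact: gc_mp.
- exact: gc_nec.
Qed.

Lemma gc_cut Gamma Delta phi :
  (forall a, Delta a -> global_conseq L Gamma a) ->
  global_conseq L Delta phi -> global_conseq L Gamma phi.
Proof.
move=> cut; elim=> {phi} [a [/cut // | La]|a b _ Ga _|a _].
- by apply: gc_hyp; right.
- exact: gc_mp.
- exact: gc_nec.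
Qed.

Lemma gc_set0 phi : global_conseq L set0 phi <-> L phi.
Proof.
split=> [|Lphi]; last by apply: gc_hyp; right.
elim=> {phi} [a [] // |a b _ La _ Lab|a _ La].
- exact: (nml_mp HL La Lab).
- exact: (nml_nec HL La).
Qed.

(** By induction on the derivation, the premises of a modus ponens are brought
    to a common [k], and a necessitation raises [k] by one.  [Delta] enters
    only through a formula [c] implying all its members, such as the
    conjunction when [Delta] is finite. *)
Lemma local_deduction Gamma Delta c phi :
  (forall a, Delta a -> global_conseq L Gamma (Imp c a)) ->
  global_conseq L (Gamma `|` Delta) phi ->
  exists k, global_conseq L Gamma (Imp (boxplus k c) phi).
Proof.
have GT := gc_theory Gamma.
move=> cDelta; elim=> {phi} [a [[Ga|/cDelta ca]|La]|a b _ [k ka] _ [l lab]|a _ [k ka]].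
- by exists 0; apply: th_impK => //; apply: gc_hyp; left.
- by exists 0.
- by exists 0; apply: th_impK => //; apply: gc_hyp; right.
- exists (maxn k l).
  have kla := th_imp_trans GT (boxplus_leq GT c (leq_maxl k l)) ka.
  have klab := th_imp_trans GT (boxplus_leq GT c (leq_maxr k l)) lab.
  by apply: (th_taut2 GT kla klab); prop_taut.
- exists k.+1; apply: (th_imp_trans GT (boxplusS_box GT _ _)).
  exact: th_box_mono.
Qed.

Lemma refuted_inconsistent Gamma c k :
  global_conseq L Gamma c -> global_conseq L Gamma (Imp (boxplus k c) Bot) ->
  inconsistent (global_conseq L) Gamma.
Proof.
have GT := gc_theory Gamma.
move=> /(boxplus_th GT k) Gk /(th_mp GT Gk) GBot phi.
by apply: (th_taut1 GT GBot); prop_taut.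
Qed.

Lemma axiom_instances n :
  global_conseq L set0
    (Imp (boxplus n (Var (v 0))) (diaplus n (boxplus n.+1 (Var (v 0))))) <->
  forall a, L (Imp (boxplus n a) (diaplus n (boxplus n.+1 a))).
Proof.
rewrite gc_set0; split=> [ax a|]; last exact.
by have := nml_subst HL (fun=> a) ax; rewrite subst_axiom.
Qed.

(** * Inconsistency lemma *)

Lemma inconsistency_lemma_of_axiom n :
  (forall a, L (Imp (boxplus n a) (diaplus n (boxplus n.+1 a)))) ->
  has_inconsistency_lemma v (global_conseq L).
Proof.
move=> ax.
pose conj m : form V := \big[@And V/Top]_(i < m) Var (v i).
exists (fun m => [set Imp (boxplus n (conj m)) Bot]) => m _; split.
- exact: finite_set1.
- move=> _ ->; rewrite /Fm /= setU0.
  apply: subset_trans (@vars_boxplus _ _ _) _; apply: vars_bigand => i _ ->.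
  by exists (i : nat) => /=.
move=> Gamma alpha.
pose c := \big[@And V/Top]_(i < m) alpha i.
have conjE : subst (assign v alpha) (conj m) = c.
  by rewrite subst_bigand; apply: eq_bigr => i _; apply: assignE.
have GT := gc_theory Gamma.
split=> [inc _ [_ -> <-] | ref].
- rewrite /= subst_boxplus conjE.
  have [|k refk] := local_deduction (c := c) _ (inc Bot).
    by move=> _ [i _ <-]; apply: bigandE; rewrite ?mem_index_enum.
  by apply: refutation_descends refk => // a; apply: gc_hyp; right.
- apply: (@refuted_inconsistent _ c n).
    apply: bigand_th => [|i]; first exact: gc_theory.
    by apply: gc_hyp; left; right; exists i.
  apply: (gc_cut (Delta := Gamma)) => [a Ga|]; first by apply: gc_hyp; left; left.
  apply: ref; exists (Imp (boxplus n (conj m)) Bot) => //.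
  by rewrite /= subst_boxplus conjE.
Qed.

Lemma axiom_of_inconsistency_lemma :
  has_inconsistency_lemma v (global_conseq L) ->
  exists n, forall a, L (Imp (boxplus n a) (diaplus n (boxplus n.+1 a))).
Proof.
move=> [Psi /(_ 1 isT) [_ _ IL]].
(* [Psi 1] is instantiated at its own variable, so that its members serve both
   as hypotheses and as conclusions. *)
pose p := Var (v 0); pose alpha (i : 'I_1) : form V := Var (v i).
have instE phi : subst (assign v alpha) phi = phi.
  by apply: subst_Var => x; rewrite /assign; case: pickP => // i /eqP <-.
have alphap a : range alpha a -> a = p.
  by move=> [i _ <-]; rewrite (ord1 i).
have rangep : range alpha p by exists ord0.
(* The value [k] obtained here is fixed before [d] is chosen. *)
have [k PsiE] : exists k, global_conseq L (Psi 1) (Imp (boxplus k p) Bot).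
  apply: (local_deduction (Delta := range alpha)) => [a /alphap -> |].
    by apply: th_imp_refl; apply: gc_theory.
  by apply: (IL _ _).2 => _ [psi Ppsi <-]; rewrite instE; apply: gc_hyp; left.
pose d : form V := Neg (boxplus k.+1 p).
have dPsi phi : Psi 1 phi -> global_conseq L [set d] phi.
  move=> Pphi; apply: ((IL [set d] alpha).1 _ phi); last by exists phi.
  apply: (@refuted_inconsistent _ p k.+1); first by apply: gc_hyp; left; right.
  have dT : global_conseq L ([set d] `|` range alpha) d.
    by apply: gc_hyp; left; left.
  by apply: (th_taut1 (gc_theory _) dT); prop_taut.
have T0 := gc_theory set0.
have [m ded] : exists m,
    global_conseq L set0 (Imp (boxplus m d) (Imp (boxplus k p) Bot)).
  apply: (local_deduction (Delta := [set d])) => [a -> |]; first exact: th_imp_refl.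
  by rewrite set0U; apply: gc_cut dPsi PsiE.
have refl : global_conseq L set0 (Imp (boxplus k p) (diaplus m (boxplus k.+1 p))).
  by apply: diaplus_of_boxplus_neg => //; apply: (th_taut1 T0 ded); prop_taut.
exists (k + m) => a; apply/gc_set0; apply: bounds_agree => // {}a.
apply/gc_set0; move/gc_set0: refl => /(nml_subst HL (fun=> a)).
by rewrite subst_axiom.
Qed.

End GlobalConsequence.

Theorem theorem9p1 (V : eqType) (v : nat -> V) (v_inj : injective v)
    (L : set (form V)) (HL : normal_modal_logic v L) :
  (has_inconsistency_lemma v (global_conseq L) <->
   exists n : nat,
     global_conseq L set0
       (Imp (boxplus n (Var (v 0))) (diaplus n (boxplus n.+1 (Var (v 0)))))) /\
  (forall n : nat,
     global_conseq L set0
       (Imp (boxplus n (Var (v 0))) (diaplus n (boxplus n.+1 (Var (v 0))))) <->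
     forall alpha : form V,
       L (Imp (boxplus n alpha) (diaplus n (boxplus n.+1 alpha)))).
Proof.
split; last exact: axiom_instances.
split=> [/(axiom_of_inconsistency_lemma v_inj HL) [n ax] | [n ax]].
  by exists n; apply/(axiom_instances HL).
exact/(inconsistency_lemma_of_axiom v_inj HL)/(axiom_instances HL n).1.
Qed.
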